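(* Let $A$ be a complex semisimple Banach algebra with identity and suppose that $\mathrm{Soc}\,A \neq \{0\}$. Then $A$ is prime if and only if for any $a, b \in A$ the following two conditions are equivalent: (i) $\rho(ax) \leq \rho(bx)$ for all $x \in A$; (ii) $a = \lambda b$ for some $\lambda \in \mathbb{C}$ with $|\lambda| \leq 1$.
   Context: $\rho(x)$ denotes the spectral radius of $x \in A$. $\mathrm{Soc}\,A$ is the socle of $A$ (the sum of the minimal left ideals of $A$, or $\{0\}$ if there are none); for semisimple $A$ it coincides with the set of $a \in A$ of finite rank, where $\mathrm{rank}(a) = \sup_{x \in A} \#(\sigma(xa) \setminus \{0\})$ and $\sigma$ denotes the spectrum. $A$ is prime if all nonzero two-sided ideals $I$ and $J$ of $A$ satisfy $IJ \neq \{0\}$. *)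

(* Defs.v *)
(* The complex numbers are R[i] for R : realType. *)
From HB Require Import structures.
From mathcomp Require Import all_boot all_order all_algebra.
From mathcomp Require Import complex.
From mathcomp Require Import all_classical all_reals all_analysis.

Set Implicit Arguments.
Unset Strict Implicit.
Unset Printing Implicit Defensive.

Import Order.TTheory GRing.Theory Num.Theory.
Import numFieldNormedType.Exports.

Local Open Scope classical_set_scope.
Local Open Scope ring_scope.

(* Hierarchy Builder cannot join GRing.PzSemiRing with Num.SemiNormedZmodule (the
   only structure inheriting from both is Num.NumDomain), so the multiplication is
   a field of the mixin and the algebra structure is declared as an instance.
   The normalization `|1| = 1 is not required. *)
HB.mixin Record CompleteNormedModule_isBanachAlgebra (K : numFieldType) A
    & CompleteNormedModule K A := {
  banach_one : A;
  banach_mul : A -> A -> A;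
  banach_mulA : associative banach_mul;
  banach_mul1r : left_id banach_one banach_mul;
  banach_mulr1 : right_id banach_one banach_mul;
  banach_mulrDl : left_distributive banach_mul +%R;
  banach_mulrDr : right_distributive banach_mul +%R;
  banach_oner_neq0 : banach_one != 0;
  banach_scalerAl : forall (l : K) (x y : A),
    l *: banach_mul x y = banach_mul (l *: x) y;
  banach_scalerAr : forall (l : K) (x y : A),
    l *: banach_mul x y = banach_mul x (l *: y);
  banach_ler_normM : forall x y : A, `|banach_mul x y| <= `|x| * `|y|
}.

#[short(type="banachAlgType")]
HB.structure Definition BanachAlgebra (K : numFieldType) :=
  {A of CompleteNormedModule K A & CompleteNormedModule_isBanachAlgebra K A}.

Section BanachAlgebraAlgebra.
Variables (K : numFieldType) (A : banachAlgType K).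

HB.instance Definition _ := GRing.Zmodule_isNzRing.Build A
  banach_mulA banach_mul1r banach_mulr1 banach_mulrDl banach_mulrDr
  banach_oner_neq0.

HB.instance Definition _ := GRing.Lmodule_isLalgebra.Build K A banach_scalerAl.

HB.instance Definition _ := GRing.Lalgebra_isAlgebra.Build K A banach_scalerAr.

Lemma ler_normM (x y : A) : `|x * y| <= `|x| * `|y|.
Proof. exact: banach_ler_normM. Qed.

End BanachAlgebraAlgebra.

(* Ideals as sets.  In a unital algebra l *: x = l%:A * x = x * l%:A, so the
   ideals below are automatically linear subspaces. *)
Section Ideals.
Variable A : nzRingType.
Implicit Types (I J L M S : set A).

Definition left_ideal I : Prop :=
  [/\ I 0, forall x y, I x -> I y -> I (x + y)
    & forall a x, I x -> I (a * x)].

Definition two_sided_ideal I : Prop :=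
  left_ideal I /\ forall a x, I x -> I (x * a).

Definition minimal_left_ideal L : Prop :=
  [/\ left_ideal L, L <> [set 0]
    & forall I, left_ideal I -> I `<=` L -> I = [set 0] \/ I = L].

Definition maximal_left_ideal M : Prop :=
  [/\ left_ideal M, M <> setT
    & forall I, left_ideal I -> M `<=` I -> I = M \/ I = setT].

Definition jacobson_radical : set A :=
  \bigcap_(M in [set M | maximal_left_ideal M]) M.

Definition semisimple : Prop := jacobson_radical = [set 0].

Definition finite_sums S : set A :=
  [set x | exists2 s : seq A, {in s, forall y, S y} & x = \sum_(y <- s) y].

(* This is [set 0] when there is no minimal left ideal. *)
Definition socle : set A :=
  finite_sums (\bigcup_(L in [set L | minimal_left_ideal L]) L).

Definition ideal_product I J : set A :=
  finite_sums [set x * y | x in I & y in J].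

Definition prime_ring : Prop :=
  forall I J, two_sided_ideal I -> two_sided_ideal J ->
    I <> [set 0] -> J <> [set 0] -> ideal_product I J <> [set 0].

Definition invertible (x : A) : Prop := exists y, y * x = 1 /\ x * y = 1.

End Ideals.

Arguments semisimple A : clear implicits.
Arguments socle A : clear implicits.
Arguments prime_ring A : clear implicits.

Section Spectrum.
Variables (R : realType) (A : banachAlgType R[i]).

Definition spectrum (x : A) : set R[i] := [set l | ~ invertible (l%:A - x)].

(* Normc.normc is the modulus with values in R (`|l| has values in R[i]).  In a
   Banach algebra the spectrum is nonempty and bounded, so the sup is genuine. *)
Definition spectral_radius (x : A) : R :=
  sup [set Normc.normc l | l in spectrum x].

End Spectrum.

(* Main.v *)
Require Import Defs.
From mathcomp Require Import all_boot all_order all_algebra.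
From mathcomp Require Import complex lra.
From mathcomp Require Import all_classical all_reals all_analysis.

Import Order.TTheory GRing.Theory Num.Theory.
Import numFieldNormedType.Exports.

Local Open Scope classical_set_scope.
Local Open Scope ring_scope.

(** Suppose first that domination of spectral radii forces proportionality, and
    let I J = 0 with nonzero a in I and c in J.  For every x the elements a x and
    c x annihilate each other on both sides, so off 0 the spectrum of a x is
    contained in that of (a + c) x.  Hence a is dominated by a + c, so
    a = l (a + c), which is impossible because I and J meet in 0
    ([prime_of_radius_domination]).

    Conversely let A be prime.  If a = l b with |l| <= 1, then a is dominated by b
    because the spectral radius is homogeneous; the point is that domination
    implies proportionality.  A nonzero socle provides a minimal idempotent e
    ([minimal_left_ideal_idempotent]), whose corner e A e consists of the scalar
    multiples of e ([corner_scalar]); write e x e = tau x e.  The spectral radius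
    of a u e v is |tau (v a u)| ([spectral_radius_rank_one]), so the domination of
    a by b says |tau (v a u)| <= |tau (v b u)| for all u and v.  As a functional
    of v the left side is a multiple of the right side, and primeness turns this
    into a u e = l b u e, where l may still depend on u.  Two linear maps that are
    pointwise proportional are proportional ([locally_scalar_multiple]), so
    (a - l b) A e = 0, and a = l b by primeness again.

    The analytic core is that a corner which is a division ring is reduced to
    scalars.  It rests on [entire_resolvent_powers_vanish]: when 1 - l x is
    invertible for every scalar l, r^N x^N tends to 0 for every r, along the
    powers N of 2.  In place of a contour integral, the proof averages the
    resolvent over the roots of unity of order N, by repeated use of
    (1 - t^2)^-1 = ((1 - t)^-1 + (1 + t)^-1) / 2.  The averages
    (1 - r^N x^N)^-1 are Lipschitz in r with a constant independent of N, and
    this lets the convergence to 0 spread from r = 0 up to any given radius in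
    finitely many steps of equal length. *)

Set Implicit Arguments.
Unset Strict Implicit.
Unset Printing Implicit Defensive.

(** * Ideals, idempotents and primeness *)

Section RingTheory.
Variable A : nzRingType.
Implicit Types (I J L : set A) (x y z e : A).

Lemma left_ideal_principal z : left_ideal [set x * z | x in [set: A]].
Proof.
split; first by exists 0; rewrite ?mul0r.
- by move=> _ _ [x _ <-] [y _ <-]; exists (x + y); rewrite ?mulrDl.
- by move=> a _ [x _ <-]; exists (a * x); rewrite ?mulrA.
Qed.

Lemma left_idealN I x : left_ideal I -> I x -> I (- x).
Proof. by case=> _ _ IM Ix; rewrite -mulN1r; apply: IM. Qed.

(** If [z] were outside a maximal left ideal M, then 1 = m + r z with m in M,
    and multiplying by [z] on the left would give z = z m in M. *)
Lemma semisimple_sandwich_eq0 z :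
  semisimple A -> (forall r, z * r * z = 0) -> z = 0.
Proof.
move=> ssA zAz; suff: jacobson_radical z by rewrite ssA.
move=> M [Mid MnT Mmax]; apply: contrapT => Mz.
have [M0 MD MM] := Mid.
pose I := [set y | exists m r, M m /\ y = m + r * z].
have Iid : left_ideal I.
  split; first by exists 0, 0; rewrite mul0r addr0.
  - move=> _ _ [m [r [Mm ->]]] [n [s [Mn ->]]]; exists (m + n), (r + s).
    by split; [exact: MD | rewrite mulrDl addrACA].
  - move=> a _ [m [r [Mm ->]]]; exists (a * m), (a * r).
    by split; [exact: MM | rewrite mulrDr mulrA].
have MI : M `<=` I by move=> m Mm; exists m, 0; rewrite mul0r addr0.
case: (Mmax I Iid MI) => IE.
  by apply: Mz; rewrite -IE; exists 0, 1; rewrite mul1r add0r.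
have [m [r [Mm e1]]] : I 1 by rewrite IE.
apply: Mz; rewrite -[z]mulr1 e1 mulrDr mulrA zAz addr0; exact: MM.
Qed.

Lemma finite_sums1 (S : set A) x : S x -> finite_sums S x.
Proof.
move=> Sx; exists [:: x]; last by rewrite big_seq1.
by move=> y; rewrite inE => /eqP ->.
Qed.

Lemma ideal_product_eq0 I J : (forall x y, I x -> J y -> x * y = 0) ->
  ideal_product I J = [set 0] :> set A.
Proof.
move=> IJ0; rewrite predeqE => z; split=> [[s sIJ ->]|->]; last first.
  by exists [::] => //; rewrite big_nil.
rewrite /= big_seq big1 // => y /sIJ [u Iu [v Jv <-]]; exact: IJ0.
Qed.

Lemma set_neq0P I : I 0 -> I <> [set 0] -> exists2 x, I x & x <> 0.
Proof.
move=> I0 In0; apply: contrapT => h; apply: In0; rewrite predeqE => x.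
by split=> [Ix|->//]; apply: contrapT => x0; apply: h; exists x.
Qed.

Definition ideal_gen z : set A :=
  finite_sums [set p.1 * z * p.2 | p in [set: A * A]].

Lemma two_sided_ideal_gen z : two_sided_ideal (ideal_gen z).
Proof.
have mapP (f : A -> A) : {morph f : x y / x + y} -> f 0 = 0 ->
    (forall u v, exists u' v', f (u * z * v) = u' * z * v') ->
    forall x, ideal_gen z x -> ideal_gen z (f x).
  move=> fD f0 fS x [s sS ->]; exists (map f s).
    move=> _ /mapP [y /sS [[u v] _ <-] ->] /=.
    by have [u' [v' ->]] := fS u v; exists (u', v').
  by rewrite big_map (big_morph f fD f0).
split; [split|].
- by exists [::] => //; rewrite big_nil.
- move=> _ _ [s sS ->] [t tS ->]; exists (s ++ t); last by rewrite big_cat.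
  by move=> y; rewrite mem_cat => /orP [/sS|/tS].
- move=> a x; apply: (mapP ( *%R a)); [exact: mulrDr | exact: mulr0 |].
  by move=> u v; exists (a * u), v; rewrite !mulrA.
- move=> a x; apply: (mapP (fun y => y * a)).
    by move=> *; rewrite mulrDl.
    exact: mul0r.
  by move=> u v; exists u, (v * a); rewrite !mulrA.
Qed.

Lemma ideal_gen_id z : ideal_gen z z.
Proof. by apply: finite_sums1; exists (1, 1) => //=; rewrite mul1r mulr1. Qed.

(** The elementwise form of primeness, through the ideals generated by the two
    elements. *)
Lemma prime_ring_sandwich x y :
  prime_ring A -> (forall r, x * r * y = 0) -> x = 0 \/ y = 0.
Proof.
move=> pA xAy; apply: contrapT => /not_orP [x0 y0].
have gen_neq0 z : z <> 0 -> ideal_gen z <> [set 0].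
  by move=> z0 E; apply: z0; have := ideal_gen_id z; rewrite E.
apply: (pA _ _ (two_sided_ideal_gen x) (two_sided_ideal_gen y)) => //;
  try exact: gen_neq0.
apply: ideal_product_eq0 => _ _ [s sS ->] [t tS ->].
rewrite big_distrl /= big_seq big1 // => _ /sS [[u v] _ <-] /=.
rewrite big_distrr /= big_seq big1 // => _ /tS [[u' v'] _ <-] /=.
by rewrite !mulrA -[u * x * v * u']mulrA -(mulrA u) -(mulrA u) xAy mulr0 mul0r.
Qed.

(** Brauer's lemma, stated without the ideal: [L] is A e, and minimality says
    that A e is generated by each of its nonzero elements.  Semisimplicity gives
    w, z in [L] with w z nonzero; then L z = L, so e z = z for some e in [L], and
    e e - e vanishes because it annihilates [z]. *)
Lemma minimal_left_ideal_idempotent L : semisimple A -> minimal_left_ideal L ->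
  exists e, [/\ e * e = e, e <> 0 &
    forall x, x * e <> 0 -> exists y, y * (x * e) = e].
Proof.
move=> ssA [Lid Ln0 Lmin]; have [L0 LD LM] := Lid.
have [w Lw w0] := set_neq0P L0 Ln0.
have [z Lz wz] : exists2 z, L z & w * z <> 0.
  apply: contrapT => h; apply: w0; apply: semisimple_sandwich_eq0 => // r.
  rewrite -mulrA; apply: contrapT => wrw; apply: h.
  by exists (r * w) => //; exact: LM.
have LzE : [set y * z | y in L] = L.
  have [||E|E] := Lmin [set y * z | y in L].
  - split; first by exists 0; rewrite ?mul0r.
    + by move=> _ _ [x Lx <-] [y Ly <-]; exists (x + y); rewrite ?mulrDl //; exact: LD.
    + by move=> a _ [x Lx <-]; exists (a * x); rewrite ?mulrA //; exact: LM.
  - by move=> _ [y Ly <-]; exact: LM.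
  - by case: wz; have : [set y * z | y in L] (w * z) by [exists w]; rewrite E.
  - by [].
have [e Le ez] : [set y * z | y in L] z by rewrite LzE.
(* The left annihilator of [z] in [L] is a proper sub-ideal of [L]. *)
have annL0 : [set y | L y /\ y * z = 0] = [set 0].
  have [||E|E] := Lmin [set y | L y /\ y * z = 0].
  - split; first by rewrite /= mul0r.
    + by move=> x y [Lx xz] [Ly yz]; split; [exact: LD | rewrite mulrDl xz yz addr0].
    + by move=> a x [Lx xz]; split; [exact: LM | rewrite -mulrA xz mulr0].
  - by move=> y [].
  - by [].
  - by case: wz; move: Lw; rewrite -E => -[].
have eK x : L x -> x * e = x.
  move=> Lx; apply/eqP; rewrite -subr_eq0; apply/eqP.
  have : [set y | L y /\ y * z = 0] (x * e - x).
    split; first by apply: LD; [exact: LM | exact: left_idealN].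
    by rewrite mulrBl -mulrA ez subrr.
  by rewrite annL0.
have e0 : e <> 0 by move=> e0; apply: wz; rewrite -ez e0 mul0r mulr0.
exists e; split=> //; first exact: eK.
move=> x xe0; have [||E|E] := Lmin [set y * (x * e) | y in [set: A]].
- exact: left_ideal_principal.
- by move=> _ [y _ <-]; exact/LM/LM.
- have : [set y * (x * e) | y in [set: A]] (1 * (x * e)) by exists 1.
  by rewrite E /= mul1r.
- by move: Le; rewrite -{1}E => -[y _ ye]; exists y.
Qed.

(** The corner e A e of a minimal idempotent is a division ring with unit [e]:
    left inverses come from minimality, and a left inverse has a left inverse. *)
Lemma corner_inverse e x : e * e = e ->
  (forall x, x * e <> 0 -> exists y, y * (x * e) = e) ->
  e * x * e = x -> x <> 0 -> exists y, [/\ e * y * e = y, y * x = e & x * y = e].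
Proof.
move=> ee emin.
have linv z : e * z * e = z -> z <> 0 -> exists y, e * y * e = y /\ y * z = e.
  move=> ez z0; have ze : z * e = z by rewrite -ez -!mulrA ee.
  have ez' : e * z = z by rewrite -ez !mulrA ee.
  have /emin [y] : z * e <> 0 by rewrite ze.
  rewrite ze => yz; exists (e * y * e); split; first by rewrite !mulrA ee -!mulrA ee.
  by rewrite -!mulrA ez' yz ee.
move=> ex x0; have [y [ey yx]] := linv x ex x0.
have y0 : y <> 0.
  move=> y0; apply: x0; rewrite -ex -yx y0.
  by rewrite mul0r mulr0.
have [w [ew wy]] := linv y ey y0.
have wx : w = x.
  have <- : w * e = w by rewrite -ew -!mulrA ee.
  by rewrite -yx mulrA wy -ex !mulrA ee.
by exists y; split=> //; rewrite -wx.
Qed.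

(** An inverse in the corner e A e becomes an inverse in A once the
    complementary idempotent 1 - e is added to both factors. *)
Lemma mul_complement_corner e w z :
  e * e = e -> w * e = w -> e * z = z -> w * z = e ->
  (1 - e + w) * (1 - e + z) = 1.
Proof.
move=> ee we ez wz; rewrite -[RHS](subrK e).
have : w * (1 - e) = 0 by rewrite mulrBr mulr1 we subrr.
have : (1 - e) * z = 0 by rewrite mulrBl mul1r ez subrr.
have : (1 - e) * (1 - e) = 1 - e by rewrite mulrBr mulr1 mulrBl mul1r ee subrr subr0.
move: (1 - e) => p pp pz wp.
by rewrite mulrDl !mulrDr pp pz wp addr0 add0r wz.
Qed.

End RingTheory.

(** * Two linear maps that agree pointwise up to a scalar *)

(** Fix [x0] with [T x0] nonzero.  If [T x] is a multiple of [T x0], the relation at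
    x - c x0, where [T] vanishes, transports the scalar of [x0] to [x]; otherwise
    [T x] and [T x0] are independent and the relation at x0 + x forces the scalars
    to agree.  The set [C] carries along a bound on the scalar. *)
Lemma locally_scalar_multiple (K : fieldType) (V W : lmodType K) (S T : V -> W)
    (C : set K) : linear S -> linear T ->
  (forall x, exists l, C l /\ S x = l *: T x) ->
  exists l, C l /\ forall x, S x = l *: T x.
Proof.
move=> linS linT ST.
have subZ (f : V -> W) : linear f -> forall x y c, f (x - c *: y) = f x - c *: f y.
  by move=> linf x y c; have := linf (- c) y x; rewrite !scaleNr ![- _ + _]addrC.
have addl (f : V -> W) : linear f -> forall x y, f (x + y) = f x + f y :> W.
  by move=> linf x y; have := linf 1 x y; rewrite !scale1r.
case: (pselect (exists x, T x <> 0)) => [[x0 Tx0]|T0]; last first.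
  have [l [Cl _]] := ST 0; exists l; split=> // x.
  have Tx : T x = 0 by apply: contrapT => Tx; apply: T0; exists x.
  by have [m [_ ->]] := ST x; rewrite Tx !scaler0.
have [l [Cl Sx0]] := ST x0; exists l; split=> // x.
case: (pselect (exists c, T x = c *: T x0)) => [[c Tx]|Tx].
  have [m [_]] := ST (x - c *: x0).
  rewrite !subZ// Tx subrr scaler0 Sx0 => /eqP; rewrite subr_eq0 => /eqP ->.
  by rewrite !scalerA mulrC.
have [m [_ Sx]] := ST x; have [n [_]] := ST (x0 + x).
rewrite !addl// Sx0 Sx scalerDr => /eqP.
rewrite -subr_eq0 opprD addrACA -!scalerBl addr_eq0 -scaleNr opprB => /eqP E.
have nm : n = m.
  apply/eqP; rewrite -subr_eq0; apply/negP => /negP nm0; apply: Tx.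
  by exists ((n - m)^-1 * (l - n)); rewrite -scalerA E scalerA mulVf ?scale1r.
move: E; rewrite nm subrr scale0r => /eqP; rewrite scaler_eq0 => /orP[|/eqP//].
by rewrite subr_eq0 => /eqP ->.
Qed.

(** * The real-valued norm and the Neumann series *)

Section NormedAlgebra.
Local Open Scope complex_scope.
Variables (R : realType) (A : banachAlgType R[i]).
Implicit Types (x y z u v : A) (l m : R[i]).

(** The norm of the algebra takes its values in the real part of R[i]; its real
    version makes the order total and the real-field tactics available. *)
Definition nrm x : R := complex.Re `|x|.

Lemma nrmE x : `|x| = (nrm x)%:C.
Proof. by rewrite /nrm RRe_real// normr_real. Qed.

Lemma norm_complexE l : `|l| = (Normc.normc l)%:C.
Proof. by []. Qed.

Lemma nrm_ge0 x : 0 <= nrm x.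
Proof. by rewrite -lecR -nrmE normr_ge0. Qed.

Lemma nrm_eq0 x : nrm x = 0 -> x = 0.
Proof. by move=> h; apply/eqP; rewrite -normr_eq0 nrmE h. Qed.

Lemma nrm0 : nrm 0 = 0.
Proof. by rewrite /nrm normr0. Qed.

Lemma nrmN x : nrm (- x) = nrm x.
Proof. by rewrite /nrm normrN. Qed.

Lemma nrmD x y : nrm (x + y) <= nrm x + nrm y.
Proof. by rewrite -lecR rmorphD /= -!nrmE ler_normD. Qed.

Lemma nrmM x y : nrm (x * y) <= nrm x * nrm y.
Proof. by rewrite -lecR rmorphM /= -!nrmE ler_normM. Qed.

Lemma nrmZ l x : nrm (l *: x) = Normc.normc l * nrm x.
Proof. by apply: complexI; rewrite rmorphM /= -!nrmE normrZ norm_complexE. Qed.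

Lemma nrm1_gt0 : 0 < nrm 1.
Proof. by rewrite -ltcR -nrmE normr_gt0 oner_neq0. Qed.

Lemma nrmX x n : nrm (x ^+ n.+1) <= nrm x ^+ n.+1.
Proof.
elim: n => [|n IH]; first by rewrite !expr1.
rewrite exprS [leRHS]exprS (le_trans (nrmM _ _))// ler_wpM2l// ?nrm_ge0//.
Qed.

Lemma nrm_lt x (e : R) : (nrm x < e) = (`|x| < e%:C).
Proof. by rewrite nrmE ltcR. Qed.

Lemma nrm1_ge1 : 1 <= nrm 1.
Proof. by rewrite -(ler_pM2l nrm1_gt0) mulr1 -{1}[1 : A]mulr1 nrmM. Qed.

Lemma gt0_complexE (e : R[i]) : 0 < e -> e = (complex.Re e)%:C /\ 0 < complex.Re e.
Proof.
by move=> e0; have E : e = (complex.Re e)%:C;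
  [rewrite RRe_real// gtr0_real | split=> //; rewrite -ltcR -E].
Qed.

Lemma nrm_sum (I : Type) (r : seq I) (P : pred I) (F : I -> A) :
  nrm (\sum_(i <- r | P i) F i) <= \sum_(i <- r | P i) nrm (F i).
Proof.
elim/big_ind2: _ => [|x a y b xa yb|//]; first by rewrite nrm0.
by rewrite (le_trans (nrmD _ _))// lerD.
Qed.

Lemma nrm_small_eq0 x : (forall e : R, 0 < e -> nrm x <= e) -> x = 0.
Proof.
move=> h; apply: nrm_eq0; apply/eqP; rewrite eq_le nrm_ge0 andbT.
by apply/ler_addgt0Pl => e /h; rewrite addr0.
Qed.

Lemma nrmX_le x n : nrm (x ^+ n) <= nrm 1 * nrm x ^+ n.
Proof.
case: n => [|n]; first by rewrite !expr0 mulr1.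
by rewrite (le_trans (nrmX _ _))// ler_peMl ?exprn_ge0 ?nrm_ge0 ?nrm1_ge1.
Qed.

Lemma normc_ge0 l : 0 <= Normc.normc l.
Proof. by rewrite -lecR -norm_complexE normr_ge0. Qed.

Lemma normc_real (a : R) : Normc.normc a%:C = `|a|.
Proof. by rewrite /= expr0n addr0 sqrtr_sqr. Qed.

Lemma normc_leD (l : R[i]) : Normc.normc l <= `|complex.Re l| + `|complex.Im l|.
Proof.
case: l => a b /=; rewrite -[leRHS]ger0_norm ?addr_ge0// -sqrtr_sqr.
rewrite ler_wsqrtr// sqrrD !real_normK ?num_real//.
by rewrite addrAC lerDl mulrn_wge0// mulr_ge0.
Qed.

(** Neumann series: the partial sums s_n satisfy (1 - x) s_n = 1 - x^n = s_n (1 - x). *)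
Lemma one_sub_invertible x : nrm x < 1 -> invertible (1 - x).
Proof.
move=> x1.
pose s : nat -> A := series (fun n => x ^+ n).
have qn : `|nrm x| < 1 by rewrite ger0_norm ?nrm_ge0.
have cs : cvg (s @ \oo).
  apply/cauchy_cvgP/cauchy_seriesP => e /gt0_complexE [-> e0].
  have /cauchy_cvgP/cauchy_seriesP /(_ _ e0) :=
    is_cvg_geometric_series (a := nrm 1) qn.
  apply: filterS => n; rewrite -nrm_lt; apply: le_lt_trans.
  rewrite (le_trans (nrm_sum _ _ _))//.
  apply: le_trans (ler_norm _); apply: ler_sum => i _; exact: nrmX_le.
pose l := lim (s @ \oo).
have sl (e : R) : 0 < e -> \forall n \near \oo, nrm (l - s n) < e.
  move=> e0; have /cvgrPdist_lt /(_ e%:C) : s @ \oo --> l by [].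
  by rewrite ltcR => /(_ e0); apply: filterS => n; rewrite nrm_lt.
have x0 (e : R) : 0 < e -> \forall n \near \oo, nrm (x ^+ n) < e.
  move=> e0; have /cvgrPdist_lt /(_ e e0) := cvg_geometric (nrm 1) qn.
  apply: filterS => n; rewrite sub0r normrN; apply: le_lt_trans.
  exact: le_trans (nrmX_le _ _) (ler_norm _).
have sE n : s n = \sum_(i < n) x ^+ i by rewrite /s /series /= big_mkord.
have xs n : x * s n = s n * x.
  rewrite sE mulr_sumr mulr_suml; apply: eq_bigr => i _.
  by rewrite -exprS exprSr.
have s1 n : (1 - x) * s n = 1 - x ^+ n.
  elim: n => [|n IH]; first by rewrite sE big_ord0 mulr0 expr0 subrr.
  rewrite sE big_ord_recr /= -sE mulrDr IH mulrBl mul1r -exprS.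
  by rewrite addrA subrK.
have s2 n : s n * (1 - x) = 1 - x ^+ n.
  by rewrite -s1 mulrBl mulrBr mul1r mulr1 xs.
(* [f] stands for left and for right multiplication by 1 - x. *)
have key (f : A -> A) : (forall n, f (s n) = 1 - x ^+ n) ->
    (forall n, f l - f (s n) = f (l - s n)) ->
    (forall y, nrm (f y) <= nrm (1 - x) * nrm y) -> f l = 1.
  move=> fs fB fM; apply/eqP; rewrite -subr_eq0; apply/eqP.
  apply: nrm_small_eq0 => e e0; pose c := nrm (1 - x) + 1.
  have c0 : 0 < c by rewrite ltr_wpDl// nrm_ge0.
  have e1 : 0 < e / 2 / c by rewrite !divr_gt0.
  have e2 : 0 < e / 2 by rewrite divr_gt0.
  have [n [ln xn]] : exists n, nrm (l - s n) < e / 2 / c /\ nrm (x ^+ n) < e / 2.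
    near \oo => n; exists n; split; near: n; [exact: sl|exact: x0].
  have -> : f l - 1 = f (l - s n) - x ^+ n.
    by rewrite -fB fs opprB addrCA addrAC subrr add0r.
  rewrite (splitr e) (le_trans (nrmD _ _))// nrmN lerD ?(ltW xn)//.
  rewrite (le_trans (fM _))// (@le_trans _ _ (c * nrm (l - s n)))//.
    by rewrite ler_wpM2r ?nrm_ge0// lerDl.
  by rewrite mulrC -ler_pdivlMr// ltW.
exists l; split.
- by apply: (key (fun y => y * (1 - x))) => // *; rewrite ?mulrBl // mulrC nrmM.
- by apply: (key (fun y => (1 - x) * y)) => // *; rewrite ?mulrBr // nrmM.
Unshelve. all: by end_near. Qed.

End NormedAlgebra.

(** * Growth of powers of an element with entire resolvent *)

Definition inverse_of (A : nzRingType) (x u : A) : Prop := u * x = 1 /\ x * u = 1.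

Section Resolvent.
Local Open Scope complex_scope.
Variables (R : realType) (A : banachAlgType R[i]).
Implicit Types (x y z u v : A) (l m : R[i]).

Lemma resolvent_identity x u v l m :
  u * (1 - l *: x) = 1 -> (1 - m *: x) * v = 1 ->
  u - v = (l - m) *: (u * x * v).
Proof.
move=> ul vm.
have -> : u - v = u * ((1 - m *: x) - (1 - l *: x)) * v.
  by rewrite mulrBr mulrBl ul mul1r -mulrA vm mulr1.
by rewrite opprB addrC addrA subrK -scalerBl -scalerAr -scalerAl.
Qed.

Lemma inverse_one_sub_sqr (t u v : A) :
  inverse_of (1 - t) u -> inverse_of (1 + t) v ->
  inverse_of (1 - t * t) (2^-1 *: (u + v)).
Proof.
move=> [u1 u2] [v1 v2].
have E1 : 1 - t * t = (1 - t) * (1 + t) :> A.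
  by rewrite mulrBl mul1r mulrDr mulr1 opprD addrA addrK.
have E2 : 1 - t * t = (1 + t) * (1 - t) :> A.
  by rewrite mulrDl mul1r mulrBr mulr1 addrA subrK.
have two : 2^-1 *: (1 + 1 : A) = 1.
  have -> : 1 + 1 = 2%:R *: (1 : A) by rewrite scaler_nat mulr2n.
  by rewrite scalerA mulVf ?scale1r// pnatr_eq0.
split.
- rewrite -scalerAl mulrDl {1}E1 {1}E2 !mulrA u1 v1 !mul1r.
  by rewrite addrACA subrr addr0 two.
- rewrite -scalerAr mulrDr {1}E2 {1}E1 -!mulrA u2 v2 !mulr1.
  by rewrite addrACA subrr addr0 two.
Qed.

Section Entire.
Variables (x : A) (f : R[i] -> A).
Hypothesis fV : forall l, inverse_of (1 - l *: x) (f l).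

(** A bound for the resolvent near [m] without any series: in
    f l = f m + (l - m) f l x f m the last term is at most half of [f l]. *)
Lemma resolvent_near l m :
  Normc.normc (l - m) * (nrm x * nrm (f m)) <= 2^-1 -> nrm (f l) <= 2 * nrm (f m).
Proof.
move=> lm; have /eqP := resolvent_identity (fV l).1 (fV m).2.
rewrite subr_eq => /eqP E.
have : nrm (f l) <= nrm (f l) / 2 + nrm (f m).
  rewrite {1}E (le_trans (nrmD _ _))// lerD2r nrmZ.
  have h := le_trans (nrmM (f l * x) (f m))
    (ler_wpM2r (nrm_ge0 (f m)) (nrmM (f l) x)).
  apply: le_trans (ler_wpM2l (normc_ge0 _) h) _.
  by rewrite -(mulrA (nrm _)) mulrCA ler_wpM2l ?nrm_ge0.
move=> h; rewrite -ler_pdivrMl// mulrC -(lerD2l (nrm (f l) / 2)).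
by rewrite -splitr.
Qed.

(** The discs of the local bounds cover the square of side 2 r, which is compact
    as a product of two segments. *)
Lemma resolvent_bounded (r : R) :
  exists2 M : R, 0 <= M & forall l, Normc.normc l <= r -> nrm (f l) <= M.
Proof.
pose P (M : R) (p : R * R) := nrm (f (p.1 +i* p.2)) <= M.
have cK : compact (`[- r, r]%classic `*` `[- r, r]%classic : set (R * R)).
  by apply: compact_setX; exact: segment_compact.
have /compact_near_coveringP /(_ R +oo%R P) := cK.
move=> /(_ _) [].
  move=> p _.
  pose m := p.1 +i* p.2.
  pose d := 4^-1 / (nrm x * nrm (f m) + 1).
  have c0 : 0 < nrm x * nrm (f m) + 1 by rewrite ltr_wpDl// mulr_ge0// nrm_ge0.
  have d0 : 0 < d by rewrite divr_gt0.
  near=> q M.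
  rewrite /P /=; apply: (@le_trans _ _ (2 * nrm (f m))).
    2: by near: M; apply: nbhs_pinfty_ge; exact: num_real.
  apply: resolvent_near.
  have [q1 q2] : ball p d q by near: q; exact: nbhsx_ballx.
  have lm : Normc.normc ((q.1 +i* q.2) - m) <= d + d.
    apply: le_trans (normc_leD _) _; apply: lerD; rewrite /= distrC ltW//.
  apply: le_trans (ler_wpM2r _ lm) _; first by rewrite mulr_ge0// nrm_ge0.
  apply: (@le_trans _ _ ((d + d) * (nrm x * nrm (f m) + 1))).
    by rewrite ler_wpM2l ?addr_ge0 ?(ltW d0)// lerDl.
  rewrite -mulrDl -mulrA mulVf ?mulr1 ?gt_eqF//.
  lra.
move=> M [_ KM].
have KM1 := KM (Num.max M 0 + 1).
exists (Num.max M 0 + 1).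
  by rewrite addr_ge0// le_max lexx orbT.
move=> l lr.
have := KM1 _ (complex.Re l, complex.Im l).
rewrite /P /=; case: l lr => a b /= lr; apply.
  by rewrite ltr_pwDr// le_max lexx.
have [h1 h2] : `|a| <= r /\ `|b| <= r.
  by split; apply: le_trans lr; rewrite -sqrtr_sqr ler_wsqrtr// ?lerDl ?lerDr sqr_ge0.
by split; rewrite /= in_itv /= -ler_norml.
Unshelve. all: by end_near. Qed.

(** The bound does not depend on [k]: since
    (1 - t^2)^-1 = ((1 - t)^-1 + (1 + t)^-1) / 2, the inverses of
    1 - c r^N x^N with N = 2^k are averages of values of the resolvent at points
    of modulus [r], so they inherit its Lipschitz constant on the disc of radius
    [rho].  This replaces the contour integral of the resolvent. *)
Lemma averaged_resolvent_lipschitz (rho M : R) (k : nat) (r s : R) (c : R[i]) :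
  (forall l, Normc.normc l <= rho -> nrm (f l) <= M) ->
  0 <= r <= rho -> 0 <= s <= rho -> Normc.normc c = 1 -> exists u v,
    [/\ inverse_of (1 - (c * (r ^+ (2 ^ k))%:C) *: x ^+ (2 ^ k)) u,
        inverse_of (1 - (c * (s ^+ (2 ^ k))%:C) *: x ^+ (2 ^ k)) v &
        nrm (u - v) <= M * nrm x * M * `|r - s|].
Proof.
move=> fM rI sI; elim: k c => [|k IH] c c1.
  exists (f (c * r%:C)), (f (c * s%:C)); split; try exact: fV.
  have nc (a : R) : Normc.normc (c * a%:C) = `|a|.
    by rewrite Normc.normcM c1 mul1r normc_real.
  have bd (a : R) : 0 <= a <= rho -> nrm (f (c * a%:C)) <= M.
    by move=> /andP[a0 aI]; apply: fM; rewrite nc ger0_norm.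
  rewrite (resolvent_identity (fV _).1 (fV _).2) nrmZ -mulrBr -rmorphB nc mulrC.
  rewrite ler_wpM2r//.
  apply: le_trans (nrmM _ _) _; apply: ler_pM; rewrite ?nrm_ge0 ?bd//.
  apply: le_trans (nrmM _ _) _; apply: ler_pM; rewrite ?nrm_ge0 ?bd//.
pose h := sqrtc c.
have hh : h * h = c by rewrite -expr2 sqr_sqrtc.
have h1 : Normc.normc h = 1.
  have : Normc.normc h ^+ 2 = 1 by rewrite expr2 -Normc.normcM hh.
  by move=> /eqP; rewrite sqrp_eq1 ?normc_ge0// => /eqP.
have Nh1 : Normc.normc (- h) = 1 by rewrite normcN.
have [u [v [uI vI uv]]] := IH h h1.
have [u' [v' [uI' vI' uv']]] := IH (- h) Nh1.
exists (2^-1 *: (u + u')), (2^-1 *: (v + v')).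
have sq (a : R) w w' :
   inverse_of (1 - (h * (a ^+ (2 ^ k))%:C) *: x ^+ (2 ^ k)) w ->
   inverse_of (1 - (- h * (a ^+ (2 ^ k))%:C) *: x ^+ (2 ^ k)) w' ->
   inverse_of (1 - (c * (a ^+ (2 ^ k.+1))%:C) *: x ^+ (2 ^ k.+1)) (2^-1 *: (w + w')).
  rewrite mulNr scaleNr opprK => /inverse_one_sub_sqr /[apply].
  rewrite -scalerAl -scalerAr scalerA mulrACA hh -rmorphM -!exprD.
  by rewrite expnS mul2n addnn.
split; [exact: sq | exact: sq |].
rewrite -scalerBr opprD addrACA nrmZ.
have -> : Normc.normc (2^-1 : R[i]) = 2^-1.
  by rewrite Normc.normcV -(rmorph_nat (real_complex R) 2) normc_real ger0_norm.
have := le_trans (nrmD (u - v) (u' - v')) (lerD uv uv').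
lra.
Qed.

End Entire.

(** [u] lies within 1/4 of 1 and [v] within 1/4 of [u], so [v] lies within 1/2
    of 1; then z = (v - 1) - z (v - 1) bounds [z]. *)
Lemma nrm_le1_of_close_inverse y z u v :
  nrm y * nrm (1 : A) <= 8^-1 -> u * (1 - y) = 1 -> (1 - z) * v = 1 ->
  nrm (u - v) <= 4^-1 -> nrm z <= 1.
Proof.
move=> y8 u1 v2 uv.
have uy : u - 1 = u * y by rewrite -u1 mulrBr mulr1 subKr.
have zv : v - 1 = z * v by rewrite -v2 mulrBl mul1r subKr.
have n1 := nrm1_ge1 A.
have nu : nrm u <= 2 * nrm (1 : A).
  have : nrm u <= nrm u * nrm y + nrm (1 : A).
    rewrite -{1}[u](subrK 1) uy; apply: le_trans (nrmD _ _) _.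
    by rewrite lerD2r nrmM.
  have := nrm_ge0 u; have := nrm_ge0 y; nra.
have nu1 : nrm (u - 1) <= 4^-1.
  rewrite uy; apply: le_trans (nrmM _ _) _.
  have := nrm_ge0 y; nra.
have nv1 : nrm (v - 1) <= 2^-1.
  have -> : v - 1 = (u - 1) - (u - v) by rewrite opprB [RHS]addrC addrA subrK.
  apply: le_trans (nrmD _ _) _; rewrite nrmN; lra.
have : nrm z <= 2^-1 + nrm z * 2^-1.
  have {1}-> : z = (v - 1) - z * (v - 1) by rewrite mulrBr -zv mulr1 subKr.
  apply: le_trans (nrmD _ _) _; rewrite nrmN lerD//.
  by apply: le_trans (nrmM _ _) _; rewrite ler_wpM2l ?nrm_ge0.
lra.
Qed.

Definition dyadic_powers_vanish x (r : R) : Prop := forall e : R, 0 < e ->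
  \forall k \near \oo, r ^+ (2 ^ k) * nrm (x ^+ (2 ^ k)) <= e.

(** If r^N x^N tends to 0 then 1 - r^N x^N and its inverse tend to 1; by the
    uniform Lipschitz bound the inverse of 1 - (r + 2 d)^N x^N stays close to 1,
    which bounds (r + 2 d)^N x^N.  Hence s^N x^N tends to 0 for all
    s < r + 2 d. *)
Lemma dyadic_powers_vanish_extend x f (rho M r s d : R) :
  (forall l, inverse_of (1 - l *: x) (f l)) ->
  (forall l, Normc.normc l <= rho -> nrm (f l) <= M) ->
  0 < d -> M * nrm x * M * (2 * d) <= 4^-1 -> 0 <= r -> r + 2 * d <= rho ->
  0 <= s <= r + d -> dyadic_powers_vanish x r -> dyadic_powers_vanish x s.
Proof.
move=> fV fM d0 Ld rp rd_rho /andP[s0 srd] xr.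
have rd : 0 < r + 2 * d by rewrite ltr_wpDl// mulr_gt0.
have bd : \forall k \near \oo, (r + 2 * d) ^+ (2 ^ k) * nrm (x ^+ (2 ^ k)) <= 1.
  have e0 : 0 < (8 * nrm (1 : A))^-1 by rewrite invr_gt0 mulr_gt0// nrm1_gt0.
  apply: filterS (xr _ e0) => k xk.
  have rI : 0 <= r <= rho by rewrite rp; lra.
  have rdI : 0 <= r + 2 * d <= rho by rewrite ltW.
  have [u [v [[u1 _] [_ v2] uv]]] :=
    averaged_resolvent_lipschitz fV k fM rI rdI (Normc.normc1 R).
  move: u1 v2; rewrite !mul1r => u1 v2.
  have nE (a : R) : 0 <= a ->
      nrm ((a ^+ (2 ^ k))%:C *: x ^+ (2 ^ k)) = a ^+ (2 ^ k) * nrm (x ^+ (2 ^ k)).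
    by move=> a0; rewrite nrmZ normc_real ger0_norm ?exprn_ge0.
  rewrite -nE ?(ltW rd)//; rewrite -nE// in xk.
  apply: nrm_le1_of_close_inverse u1 v2 _.
    by rewrite -ler_pdivlMr ?nrm1_gt0// -invfM.
  apply: le_trans uv _; rewrite opprD addrA subrr sub0r normrN ger0_norm//.
  by rewrite mulr_ge0// ltW.
move=> e e0; pose q := (r + d) / (r + 2 * d).
have q0 : 0 <= q by rewrite divr_ge0 ?(ltW rd)// addr_ge0// ltW.
have q1 : q < 1 by rewrite ltr_pdivrMr// mul1r ltrD2l; lra.
have qn : \forall k \near \oo, q ^+ k <= e.
  have q1' : `|q| < 1 by rewrite ger0_norm.
  have /cvgrPdist_le /(_ e e0) := cvg_expr q1'.
  by apply: filterS => k; rewrite sub0r normrN ger0_norm ?exprn_ge0.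
near=> k.
apply: (@le_trans _ _ (q ^+ k)); last by near: k.
apply: (@le_trans _ _ (q ^+ (2 ^ k))).
  apply: (@le_trans _ _ (q ^+ (2 ^ k) * ((r + 2 * d) ^+ (2 ^ k) * nrm (x ^+ (2 ^ k))))).
    rewrite mulrA -exprMn ler_wpM2r ?nrm_ge0// mulfVK ?gt_eqF//.
    by rewrite lerXn2r ?nnegrE// addr_ge0// ltW.
  rewrite -[leRHS]mulr1 ler_wpM2l ?exprn_ge0//; near: k; exact: bd.
by rewrite ler_wiXn2l ?(ltW q1)// ltnW// ltn_expl.
Unshelve. all: by end_near. Qed.

(** The half of the spectral radius formula needed below, for an element whose
    nonzero spectrum is empty and along the exponents 2^k.  The set of radii at
    which the powers vanish contains 0, and below [r0] it can be enlarged by a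
    fixed step [d], since one Lipschitz constant serves the disc of radius
    [r0 + 2]. *)
Lemma entire_resolvent_powers_vanish x (r0 : R) :
  (forall l, invertible (1 - l *: x)) -> 0 <= r0 -> dyadic_powers_vanish x r0.
Proof.
move=> xinv r0_ge0; have [f fV] := choice xinv.
have [M M0 fM] := resolvent_bounded fV (r0 + 2).
pose L := M * nrm x * M.
have L0 : 0 <= L by rewrite !mulr_ge0 ?nrm_ge0.
pose d := (8 * (L + 1))^-1.
have L1 : 0 < 8 * (L + 1) by rewrite mulr_gt0// ltr_wpDl.
have d0 : 0 < d by rewrite invr_gt0.
have dL : d * (8 * (L + 1)) = 1 by rewrite mulVf// gt_eqF.
have vanish (j : nat) s : 0 <= s <= r0 -> s <= j%:R * d -> dyadic_powers_vanish x s.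
  elim: j s => [|j IH] s /andP[s0 sr0] sj.
    have -> : s = 0 by apply/eqP; rewrite eq_le s0 -(mul0r d) sj.
    by move=> e e0; near=> k; rewrite expr0n expn_eq0 /= mul0r ltW.
  have m0 : 0 <= Num.max 0 (s - d) by rewrite le_max lexx.
  have mr : Num.max 0 (s - d) <= r0 by rewrite ge_max r0_ge0 /=; lra.
  apply: (dyadic_powers_vanish_extend (r := Num.max 0 (s - d)) (d := d) fV fM) => //.
  - by rewrite -/L; lra.
  - by nra.
  - by rewrite s0 -lerBlDr le_max lexx orbT.
  - apply: IH; first by rewrite m0.
    rewrite ge_max mulr_ge0 ?(ltW d0)//=.
    by move: sj; rewrite -natr1 mulrDl mul1r lerBlDr.
have [j jr] : exists j : nat, r0 / d <= j%:R.
  by exists (Num.bound (r0 / d)); apply/ltW/archi_boundP; rewrite divr_ge0// ltW.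
by apply: (vanish j); rewrite ?r0_ge0 ?lexx// -ler_pdivrMr.
Unshelve. all: by end_near. Qed.

End Resolvent.

(** * Spectral radius *)

Section Spectrum.
Local Open Scope complex_scope.
Variables (R : realType) (A : banachAlgType R[i]).
Implicit Types (a b x y z u v e : A) (l m t : R[i]).

Lemma invertibleZ l x : l != 0 -> invertible x -> invertible (l *: x).
Proof.
move=> l0 [y [yx xy]]; exists (l^-1 *: y).
by rewrite -!scalerAl -!scalerAr !scalerA mulVf// mulfV// yx xy !scale1r.
Qed.

Lemma spectrum_normc_le x l : spectrum x l -> Normc.normc l <= nrm x.
Proof.
move=> xl; rewrite leNgt; apply/negP => lx; apply: xl.
have l0 : l != 0.
  by apply/eqP => l0; move: lx; rewrite l0 Normc.normc0 ltNge nrm_ge0.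
have -> : l%:A - x = l *: (1 - l^-1 *: x).
  by rewrite scalerBr scalerA mulfV// scale1r.
apply: invertibleZ => //; apply: one_sub_invertible.
rewrite nrmZ Normc.normcV mulrC ltr_pdivrMr ?mul1r//.
exact: le_lt_trans (nrm_ge0 _) lx.
Qed.

Lemma spectral_radius_ge x l : spectrum x l -> Normc.normc l <= spectral_radius x.
Proof.
move=> xl; apply: ub_le_sup; last by exists l.
by exists (nrm x) => _ [m xm <-]; exact: spectrum_normc_le.
Qed.

Lemma spectral_radius_le x (c : R) : 0 <= c ->
  (forall l, spectrum x l -> Normc.normc l <= c) -> spectral_radius x <= c.
Proof.
move=> c0 xc; rewrite /spectral_radius.
have [->|/set0P ne] := eqVneq [set Normc.normc l | l in spectrum x] set0.
  by rewrite sup0.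
by apply: ge_sup => // _ [l xl <-]; exact: xc.
Qed.

Lemma spectral_radius_ge0 x : 0 <= spectral_radius x.
Proof.
case: (pselect (exists l, spectrum x l)) => [[l xl]|h].
  exact: le_trans (normc_ge0 l) (spectral_radius_ge xl).
rewrite /spectral_radius (_ : [set _ | _ in _] = set0) ?sup0//.
by rewrite predeqE => c; split=> // -[l xl _]; apply: h; exists l.
Qed.

Lemma spectral_radiusZ_le x l : Normc.normc l <= 1 ->
  spectral_radius (l *: x) <= spectral_radius x.
Proof.
move=> l1; apply: spectral_radius_le; first exact: spectral_radius_ge0.
move=> m xm; have [l0|l0] := eqVneq l 0.
  have -> : m = 0; last by rewrite Normc.normc0 spectral_radius_ge0.
  apply: contrapT => /eqP m0; apply: xm; rewrite l0 scale0r subr0.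
  by apply: invertibleZ => //; exists 1; rewrite mulr1.
have xlm : spectrum x (l^-1 * m).
  move=> h; apply: xm; have := invertibleZ l0 h.
  by rewrite scalerBr !scalerA mulrA mulfV// mul1r.
apply: le_trans (spectral_radius_ge xlm); rewrite Normc.normcM Normc.normcV.
rewrite ler_peMl ?normc_ge0// invf_ge1// lt_def normc_ge0 andbT.
by apply: contra_neq l0 => /Normc.eq0_normc.
Qed.

(** The spectrum of [z] lies in {0, t}: for any other l, a multiple of
    1 + (l - t)^-1 z inverts l - z.  It contains t, with eigenvector [w]. *)
Lemma spectral_radius_quasi_idempotent z w t :
  z * z = t *: z -> z * w = t *: w -> w <> 0 ->
  spectral_radius z = Normc.normc t.
Proof.
move=> zz zw w0; apply/eqP; rewrite eq_le; apply/andP; split.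
  apply: spectral_radius_le; first exact: normc_ge0.
  move=> l zl; have [->|l0] := eqVneq l 0.
    by rewrite Normc.normc0 normc_ge0.
  have [->//|lt] := eqVneq l t.
  exfalso; apply: zl.
  have lt0 : l - t != 0 by rewrite subr_eq0.
  pose c := (l - t)^-1.
  have q1 : (l%:A - z) * (c *: z) = z.
    by rewrite -scalerAr mulrBl -scalerAl mul1r zz -scalerBl scalerA mulVf// scale1r.
  have q2 : (c *: z) * (l%:A - z) = z.
    by rewrite -scalerAl mulrBr -scalerAr mulr1 zz -scalerBl scalerA mulVf// scale1r.
  exists (l^-1 *: (1 + c *: z)); split.
  - by rewrite -scalerAl mulrDl q2 mul1r subrK scalerA mulVf// scale1r.
  - by rewrite -scalerAr mulrDr q1 mulr1 subrK scalerA mulVf// scale1r.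
apply: spectral_radius_ge => -[y [yz _]]; apply: w0.
by rewrite -[w]mul1r -yz -mulrA mulrBl -scalerAl mul1r zw subrr mulr0.
Qed.

(** Gelfand-Mazur for the corner e A e.  If x in e A e is not a multiple of [e], then
    each e - l x is nonzero, hence invertible in the corner, so that 1 - l x is
    invertible in A for every l.  The powers of [x] then decay faster than any
    geometric sequence, which contradicts y^n x^n = e for the inverse [y] of [x]. *)
Lemma corner_scalar e : e * e = e -> e <> 0 ->
  (forall x, x * e <> 0 -> exists y, y * (x * e) = e) ->
  forall x, exists l, e * x * e = l *: e.
Proof.
move=> ee e0 emin x0; apply: contrapT => nscal.
pose x := e * x0 * e; have ex : e * x * e = x by rewrite /x !mulrA ee -!mulrA ee.
have lx : e * x = x by rewrite /x !mulrA ee.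
have xr : x * e = x by rewrite /x -!mulrA ee.
have xn0 : x <> 0.
  by move=> h; apply: nscal; exists 0; rewrite scale0r -/x.
have [y [_ yx xy]] := corner_inverse ee emin ex xn0.
have xinv l : invertible (1 - l *: x).
  pose z := e - l *: x.
  have lz : e * z = z by rewrite mulrBr ee -scalerAr lx.
  have zr : z * e = z by rewrite mulrBl ee -scalerAl xr.
  have z0 : z <> 0.
    have [l0|l0] := eqVneq l 0; first by rewrite /z l0 scale0r subr0.
    move=> /eqP; rewrite subr_eq0 => /eqP eE; apply: nscal; exists l^-1.
    by rewrite -/x eE scalerA mulVf// scale1r.
  have ez : e * z * e = z by rewrite lz zr.
  have [w [ew wz zw]] := corner_inverse ee emin ez z0.
  have lw : e * w = w by rewrite -ew !mulrA ee.
  have wr : w * e = w by rewrite -ew -!mulrA ee.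
  have -> : 1 - l *: x = (1 - e) + z by rewrite addrA subrK.
  exists ((1 - e) + w); split.
  - exact: mul_complement_corner.
  - exact: mul_complement_corner.
apply: e0; apply: nrm_small_eq0 => c c0.
have [k kc] : exists k, nrm y ^+ (2 ^ k) * nrm (x ^+ (2 ^ k)) <= c.
  near \oo => k; exists k; near: k.
  exact: entire_resolvent_powers_vanish xinv (nrm_ge0 y) _ c0.
have yxn n : y ^+ n.+1 * x ^+ n.+1 = e.
  elim: n => [//|n IH]; rewrite (exprSr y) (exprS x) -mulrA (mulrA y) yx.
  by rewrite (_ : e * x ^+ n.+1 = x ^+ n.+1) // exprS mulrA lx.
apply: le_trans kc; case E: (2 ^ k)%N => [|n].
  by have := expn_gt0 2 k; rewrite E.
rewrite -(yxn n) (le_trans (nrmM _ _))// ler_wpM2r ?nrm_ge0// nrmX//.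
Unshelve. all: by end_near. Qed.

(** The element z = a u e v satisfies z^2 = t z, and a u e is an eigenvector. *)
Lemma spectral_radius_rank_one e a u v t : e <> 0 ->
  e * (v * a * u) * e = t *: e ->
  spectral_radius (a * (u * e * v)) = Normc.normc t.
Proof.
move=> e0 te; have [w0|w0] := pselect (a * u * e = 0).
  have -> : t = 0.
    apply/eqP; move/eqP: te.
    rewrite -!mulrA (mulrA a) w0 !mulr0 eq_sym scaler_eq0 => /orP[//|/eqP//].
  rewrite !mulrA w0 mul0r; apply: (@spectral_radius_quasi_idempotent 0 1).
  - by rewrite mulr0 scaler0.
  - by rewrite mul0r scale0r.
  - by apply/eqP; rewrite oner_eq0.
have zw : a * (u * e * v) * (a * u * e) = t *: (a * u * e).
  by rewrite scalerAr -te !mulrA.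
apply: (spectral_radius_quasi_idempotent _ zw w0).
have zE : a * (u * e * v) = a * u * e * v by rewrite !mulrA.
by rewrite {2}zE mulrA zw -scalerAl -zE.
Qed.

Lemma mul_orthogonal_resolvents l y z : y * z = 0 ->
  (l%:A - y) * (l%:A - z) = l *: (l%:A - (y + z)).
Proof.
move=> yz; rewrite mulrBl !mulrBr yz subr0 !mulr_algl mulr_algr.
by rewrite -!scalerBr -addrA -opprD [z + y]addrC.
Qed.

(** For l nonzero, (l - y)(l - z) = l (l - (y + z)) in either order, so an inverse
    of l - (y + z) yields one of l - y. *)
Lemma spectral_radius_le_orthogonal y z : y * z = 0 -> z * y = 0 ->
  spectral_radius y <= spectral_radius (y + z).
Proof.
move=> yz zy; apply: spectral_radius_le; first exact: spectral_radius_ge0.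
move=> l yl; have [->|l0] := eqVneq l 0.
  by rewrite Normc.normc0 spectral_radius_ge0.
apply: spectral_radius_ge => -[w [w1 w2]]; apply: yl.
have f1 := mul_orthogonal_resolvents l yz.
have f2 := mul_orthogonal_resolvents l zy; rewrite [z + y]addrC in f2.
have left_inv : (l^-1 *: (w * (l%:A - z))) * (l%:A - y) = 1.
  by rewrite -scalerAl -mulrA f2 -scalerAr w1 scalerA mulVf// scale1r.
have right_inv : (l%:A - y) * (l^-1 *: ((l%:A - z) * w)) = 1.
  by rewrite -scalerAr mulrA f1 -scalerAl w2 scalerA mulVf// scale1r.
exists (l^-1 *: (w * (l%:A - z))); split=> //.
suff -> : l^-1 *: (w * (l%:A - z)) = l^-1 *: ((l%:A - z) * w) by [].
have uniq p q r : p * q = 1 -> q * r = 1 -> p = r :> A.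
  by move=> pq qr; rewrite -[p]mulr1 -qr mulrA pq mul1r.
exact: uniq left_inv right_inv.
Qed.

(** If I J = 0 with a in I and c in J nonzero, then a x and c x are orthogonal for
    every x, so [a] is dominated by a + c.  From a = l (a + c) the element
    (1 - l) a = l c lies in the intersection of I and J, which is 0 by
    semisimplicity, and then l would be both 1 and 0. *)
Lemma prime_of_radius_domination : semisimple A ->
  (forall a b, (forall x, spectral_radius (a * x) <= spectral_radius (b * x)) ->
    exists l, a = l *: b) ->
  prime_ring A.
Proof.
move=> ssA dom I J [[I0 ID IM] Ir] [[J0 JD JM] Jr] In0 Jn0 IJ0.
have IJ x y : I x -> J y -> x * y = 0.
  move=> Ix Jy; have : ideal_product I J (x * y).
    by apply: finite_sums1; exists x => //; exists y.
  by rewrite IJ0.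
have cap x : I x -> J x -> x = 0.
  move=> Ix Jx; apply: semisimple_sandwich_eq0 => // r.
  by rewrite -mulrA IJ//; exact: JM.
have [a Ia a0] := set_neq0P I0 In0; have [c Jc c0] := set_neq0P J0 Jn0.
have [x|l al] := dom a (a + c).
  rewrite mulrDl; apply: spectral_radius_le_orthogonal.
    by apply: IJ; [exact: Ir | exact: Jr].
  by apply: cap; [apply/IM/Ir | apply/Jr/Jr].
have scale (K : set A) (KM : forall b x, K x -> K (b * x)) m x : K x -> K (m *: x).
  by move=> Kx; rewrite -[x]mul1r scalerAl; exact: KM.
have E : (1 - l) *: a = l *: c.
  by rewrite scalerBl scale1r {1}al scalerDr addrAC subrr add0r.
have la0 : (1 - l) *: a = 0.
  by apply: cap; [exact: scale | rewrite E; exact: scale].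
have lc0 : l *: c = 0 by rewrite -E.
move: la0 lc0 => /eqP; rewrite scaler_eq0 subr_eq0 => /orP[/eqP <-|/eqP//].
by rewrite scale1r.
Qed.

(** Test the hypothesis on x = u e v, with [e] a minimal idempotent and
    [tau] the functional defined by e x e = tau x e: it becomes
    |tau (v a u)| <= |tau (v b u)|.  For fixed u, these are functionals of v, so
    the first is a multiple of the second, and by primeness a u e is a multiple
    of b u e.  The scalar is the same for all u, and primeness
    gives a = l b. *)
Lemma radius_domination_scalar a b : semisimple A -> socle A <> [set 0] ->
  prime_ring A ->
  (forall x, spectral_radius (a * x) <= spectral_radius (b * x)) ->
  exists l, Normc.normc l <= 1 /\ a = l *: b.
Proof.
move=> ssA soc0 pA dom.
have [L Lmin] : exists L : set A, minimal_left_ideal L.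
  apply: contrapT => noL; apply: soc0; rewrite predeqE => x; split; last first.
    by move=> ->; exists [::] => //; rewrite big_nil.
  move=> [s sL ->]; rewrite /= big_seq big1// => y /sL [L /= Lmin].
  by exfalso; apply: noL; exists L.
have [e [ee e0 emin]] := minimal_left_ideal_idempotent ssA Lmin.
have [tau tauE] := choice (corner_scalar ee e0 emin).
have tau_le u v : Normc.normc (tau (v * a * u)) <= Normc.normc (tau (v * b * u)).
  rewrite -(spectral_radius_rank_one e0 (tauE _)).
  by rewrite -(spectral_radius_rank_one e0 (tauE _)).
have einj l m : l *: e = m *: e -> l = m.
  move=> /eqP; rewrite -subr_eq0 -scalerBl scaler_eq0 => /orP[|/eqP//].
  by rewrite subr_eq0 => /eqP.
have tau_le0 u v : e * v * (b * u * e) = 0 -> tau (v * a * u) = 0.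
  move=> bv0; apply: Normc.eq0_normc; apply/eqP; rewrite eq_le normc_ge0 andbT.
  rewrite (le_trans (tau_le u v))// (_ : tau (v * b * u) = 0) ?Normc.normc0//.
  by apply: einj; rewrite -tauE scale0r -bv0 !mulrA.
have sep w : (forall v, e * v * w = 0) -> w = 0.
  by move=> /(prime_ring_sandwich pA) [].
have aeE v u : e * v * (a * u * e) = tau (v * a * u) *: e.
  by rewrite -tauE !mulrA.
have beE v u : e * v * (b * u * e) = tau (v * b * u) *: e.
  by rewrite -tauE !mulrA.
have local u : exists l, Normc.normc l <= 1 /\ a * u * e = l *: (b * u * e).
  have [bu0|bu0] := pselect (forall v, e * v * (b * u * e) = 0).
    exists 0; split; first by rewrite Normc.normc0.
    by rewrite scale0r; apply: sep => v; rewrite aeE tau_le0 ?scale0r.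
  have [v0 bv0] : exists v, e * v * (b * u * e) <> 0.
    by apply: contrapT => h; apply: bu0 => v; apply: contrapT => hv; apply: h; exists v.
  pose t0 := tau (v0 * b * u).
  have t0n : t0 != 0.
    by apply/eqP => t00; apply: bv0; rewrite beE -/t0 t00 scale0r.
  exists (tau (v0 * a * u) / t0); split.
    rewrite Normc.normcM Normc.normcV ler_pdivrMr ?mul1r ?tau_le//.
    rewrite lt_def normc_ge0 andbT.
    by apply: contra_neq t0n => /Normc.eq0_normc.
  apply/eqP; rewrite -subr_eq0; apply/eqP; apply: sep => v.
  pose c := tau (v * b * u) / t0.
  have := @tau_le0 u (v - c *: v0) _.
  have expand w : e * (v - c *: v0) * w = e * v * w - c *: (e * v0 * w).
    by rewrite mulrBr mulrBl -scalerAr -scalerAl.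
  rewrite expand !beE scalerA mulfVK// subrr => /(_ erefl) h.
  have : e * (v - c *: v0) * (a * u * e) = 0 by rewrite aeE h scale0r.
  rewrite expand !aeE mulrBr -scalerAr aeE beE !scalerA.
  by rewrite /c mulrAC [tau (v * b * u) * _]mulrC mulrAC.
have lin y : linear (fun u => y * u * e).
  by move=> l u v; rewrite mulrDr mulrDl -scalerAr -scalerAl.
have [l [l1 lE]] := locally_scalar_multiple
  (C := [set l | Normc.normc l <= 1]) (lin a) (lin b) local.
exists l; split=> //; apply/eqP; rewrite -subr_eq0; apply/eqP.
have [r||//] := prime_ring_sandwich (x := a - l *: b) (y := e) pA.
- by rewrite mulrBl mulrBl lE -!scalerAl subrr.
- by [].
Qed.

End Spectrum.

Theorem theorem2p9 (R : realType) (A : banachAlgType R[i])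
    (A_semisimple : semisimple A) (socle_neq0 : socle A <> [set 0]) :
  prime_ring A <->
  (forall a b : A,
    (forall x : A, spectral_radius (a * x) <= spectral_radius (b * x)) <->
    (exists l : R[i], `|l| <= 1 /\ a = l *: b)).
Proof.
have normc_le1 (l : R[i]) : (`|l| <= 1) = (Normc.normc l <= 1).
  by rewrite norm_complexE -(rmorph1 (real_complex R)) lecR.
split=> [pA a b|dom].
  split=> [ab|[l [l1 ->]] x].
    have [l [l1 ->]] := radius_domination_scalar A_semisimple socle_neq0 pA ab.
    by exists l; rewrite normc_le1.
  by rewrite -scalerAl spectral_radiusZ_le// -normc_le1.
apply: prime_of_radius_domination => // a b /dom [l [_ ->]].
by exists l.
Qed.
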